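(* Fix $\vartheta>0$ and let $H_n^{(\vartheta)}$ be the height of a Hoppe tree with parameter $\vartheta$ and $n$ nodes. Let $M_n:=\mathbb{E}[H_n^{(1)}]$ be the expected height of a random recursive tree with $n$ nodes. Then for all $\alpha<\frac{1}{3e}$ and $\beta<\frac{1}{2e}$ there exist constants $C_\alpha,C_\beta>0$ such that for all $t>0$ (and all $n\ge 1$) $$\mathbb{P}\left(H_n^{(\vartheta)}-M_n\geq t \right) \leq C_\beta e^{-\beta t},\qquad \mathbb{P}\left(H_n^{(\vartheta)}-M_n\leq -t \right) \leq C_\alpha e^{-\alpha t}.$$ The constant $C_\beta$ can be chosen independently of $\vartheta$.
   Context: Hoppe tree with parameter $\vartheta>0$: the tree is grown by successive insertion of nodes. Initially there is only the root. In each step a parent node is chosen among the existing nodes, independently of the past, with probability proportional to its weight, where the root has weight $\vartheta$ and every other node has weight $1$; a new node is attached as a child of the chosen node. The Hoppe tree with $n$ nodes is the tree after $n-1$ insertions. For $\vartheta=1$ this is the random recursive tree. The height of a tree is the maximal distance of a node to the root. *)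

(* Defs.v *)
From Stdlib Require Import Reals List Arith.
Import ListNotations.
Open Scope R_scope.

(* A Hoppe tree with m+1 nodes (labelled 0..m, root 0, node k inserted at step k)
   is encoded by its parent list s of length m: the i-th entry (0-based) is the
   parent of node i+1, and it lies in {0,...,i}. *)

Fixpoint parent_lists (m : nat) : list (list nat) :=
  match m with
  | O => [ [] ]
  | S m' => flat_map (fun s => map (fun j => s ++ [j]) (seq 0 (S m')))
                     (parent_lists m')
  end.

(* Probability of a parent list under the Hoppe process with parameter th:
   node k+1 (k = 0,1,...) picks parent 0 (the root, weight th) with probability
   th/(th+k), and any given non-root node with probability 1/(th+k), since the
   total weight of the k+1 existing nodes is th + k. *)
Fixpoint hoppe_weight_from (th : R) (k : nat) (s : list nat) : R :=
  match s with
  | [] => 1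
  | p :: s' => (if Nat.eqb p 0 then th else 1) / (th + INR k)
               * hoppe_weight_from th (S k) s'
  end.

Definition hoppe_weight (th : R) (s : list nat) : R := hoppe_weight_from th 0 s.

(* Depth of node k (distance to the root); fuel k suffices since parents have
   smaller labels. *)
Fixpoint depth_fuel (fuel : nat) (s : list nat) (k : nat) : nat :=
  match k with
  | O => O
  | S k' => match fuel with
            | O => O
            | S f => S (depth_fuel f s (nth k' s O))
            end
  end.

Definition depth (s : list nat) (k : nat) : nat := depth_fuel k s k.

Definition height (s : list nat) : nat :=
  fold_right Nat.max O (map (depth s) (seq 0 (S (length s)))).

Definition prob_height (th : R) (n : nat) (P : nat -> Prop)
  (Pdec : forall h, {P h} + {~ P h}) : R :=
  fold_right Rplus 0
    (map (fun s => if Pdec (height s) then hoppe_weight th s else 0)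
         (parent_lists (n - 1))).

Definition prob_height_ge (th : R) (n : nat) (f : nat -> R) (a : R) : R :=
  prob_height th n (fun h => a <= f h) (fun h => Rle_dec a (f h)).
Definition prob_height_le (th : R) (n : nat) (f : nat -> R) (a : R) : R :=
  prob_height th n (fun h => f h <= a) (fun h => Rle_dec (f h) a).

Definition exp_height (th : R) (n : nat) : R :=
  fold_right Rplus 0
    (map (fun s => hoppe_weight th s * INR (height s)) (parent_lists (n - 1))).

Definition M (n : nat) : R := exp_height 1 n.

(* Main.v *)
Require Import Defs.
From Coquelicot Require Import Coquelicot.
From Stdlib Require Import Reals Arith Lia Lra Permutation List.
Import ListNotations.
Open Scope R_scope.

(* Give a node at depth [d] the capacity [c - d]: the height stays below [c] as long as no
   capacity vanishes. With [a_c n] the probability that a random recursive tree with [n + 1]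
   nodes has height less than [c], the generating functions [f_c = sum_n a_c n x^n] satisfy
   [f_c' = f_c f_(c-1)]. Hence [u_c = (1 - x) f_c], the probability of height less than [c] for
   a geometric number of nodes, satisfies [u_c' = - u_c (1 - u_(c-1)) / (1 - x)].

   By induction on [c], a barrier argument for this system compares consecutive levels at the
   same [x]:
     [1 - u_c >= 3/2 (1 - u_(c+1)) u_(c+1)]   and   [u_c <= (7 u_(c+1) + u_(c+1)^3) / 8].
   Let [K] be the level at which [1 - u] drops below 1/6. The first inequality makes [1 - u_c]
   decay above [K] with ratio [4/5 < exp (-1/(2e))], the second makes [u_c] decay below [K] with
   a ratio tending to [7/8 < exp (-1/(3e))]. For [x = 1 - 1/n] both bounds transfer to the tree
   with [n] nodes at the cost of a constant factor; summing them gives [M n = K + O(1)].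

   The probability of height less than [c] in a Hoppe tree increases with the root weight.
   Letting that weight tend to 0 gives the upper tail uniformly in [th]; for the lower tail it
   may be assumed to be at least 1, and splitting off the subtree of the first child of the root
   bounds the probability by [th] times an average of the [a_(c-1) i], [i < n]. *)

(** * Surviving insertions *)

Definition lsum {A : Type} (f : A -> R) (l : list A) : R :=
  fold_right Rplus 0 (map f l).

Lemma lsum_cons {A} (f : A -> R) x l : lsum f (x :: l) = f x + lsum f l.
Proof. reflexivity. Qed.

Lemma lsum_app {A} (f : A -> R) l1 l2 : lsum f (l1 ++ l2) = lsum f l1 + lsum f l2.
Proof.
  induction l1 as [|x l1 IH]; cbn [app]; [unfold lsum; simpl; lra|].
  rewrite !lsum_cons, IH; lra.
Qed.

Lemma lsum_map {A B} (f : B -> R) (g : A -> B) l : lsum f (map g l) = lsum (fun x => f (g x)) l.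
Proof. unfold lsum; now rewrite map_map. Qed.

Lemma lsum_flat_map {A B} (f : B -> R) (g : A -> list B) l :
  lsum f (flat_map g l) = lsum (fun x => lsum f (g x)) l.
Proof.
  induction l as [|x l IH]; [reflexivity|].
  cbn [flat_map]; rewrite lsum_app, lsum_cons, IH; reflexivity.
Qed.

Lemma lsum_ext {A} (f g : A -> R) l : (forall x, In x l -> f x = g x) -> lsum f l = lsum g l.
Proof.
  intros H; unfold lsum; f_equal; now apply map_ext_in.
Qed.

Lemma lsum_le {A} (f g : A -> R) l : (forall x, In x l -> f x <= g x) -> lsum f l <= lsum g l.
Proof.
  induction l as [|x l IH]; intros H; [apply Rle_refl|].
  rewrite !lsum_cons; apply Rplus_le_compat; [apply H; now left|].
  apply IH; intros y Hy; apply H; now right.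
Qed.

Lemma lsum_scal {A} (c : R) (f : A -> R) l : lsum (fun x => c * f x) l = c * lsum f l.
Proof.
  induction l as [|x l IH]; [unfold lsum; simpl; lra|]; rewrite !lsum_cons, IH; lra.
Qed.

Lemma lsum_plus {A} (f g : A -> R) l : lsum (fun x => f x + g x) l = lsum f l + lsum g l.
Proof.
  induction l as [|x l IH]; [unfold lsum; simpl; lra|]; rewrite !lsum_cons, IH; lra.
Qed.

Lemma lsum_ge_0 {A} (f : A -> R) l : (forall x, In x l -> 0 <= f x) -> 0 <= lsum f l.
Proof.
  intros H; apply Rle_trans with (lsum (fun _ => 0 * 0) l); [rewrite lsum_scal; lra|].
  apply lsum_le; intros x Hx; specialize (H x Hx); lra.
Qed.

Lemma lsum_perm {A} (f : A -> R) l l' : Permutation l l' -> lsum f l = lsum f l'.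
Proof.
  induction 1; rewrite ?lsum_cons; lra.
Qed.

Lemma lsum_Forall2_le {A B} (f : A -> R) (g : B -> R) (P : A -> B -> Prop) l l' :
  (forall x y, In x l -> P x y -> f x <= g y) -> Forall2 P l l' -> lsum f l <= lsum g l'.
Proof.
  intros H F; induction F as [|x y l l' Hxy F IH]; [apply Rle_refl|].
  rewrite !lsum_cons; apply Rplus_le_compat; [apply H; auto; now left|].
  apply IH; intros z t Hz; apply H; now right.
Qed.

(* A state is the list of the (weight, capacity) pairs of the nodes of a growing
   tree, where a node at depth [d] has capacity [k + 1 - d]: the tree has height at
   most [k] iff every capacity is positive. *)
Definition state := list (R * nat).

Definition weight (L : state) : R := lsum fst L.

Definition alive (L : state) : R := if forallb (fun p => 0 <? snd p)%nat L then 1 else 0.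

Definition child (p : R * nat) : R * nat := (1, pred (snd p)).

(** The probability that [r] further insertions keep every capacity positive, by conditioning on the
    first of them. Testing [alive] only at the end suffices, since entries are never removed or
    changed. *)
Fixpoint surv (r : nat) (L : state) : R :=
  match r with
  | O => alive L
  | S r' => lsum (fun p => fst p * surv r' (L ++ [child p])) L / weight L
  end.

Lemma weight_child L p : weight (L ++ [child p]) = weight L + 1.
Proof. unfold weight; rewrite lsum_app; unfold lsum at 2; simpl; lra. Qed.

Definition state_le (L L' : state) : Prop :=
  Forall2 (fun p q => fst p = fst q /\ 0 <= fst p /\ (snd p <= snd q)%nat) L L'.

Definition nonneg (L : state) : Prop := Forall (fun p => 0 <= fst p) L.

Lemma nonneg_child L p : nonneg L -> nonneg (L ++ [child p]).
Proof. intros H; apply Forall_app; split; [assumption|]; constructor; simpl; auto; lra. Qed.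

Lemma nonneg_in L p : nonneg L -> In p L -> 0 <= fst p.
Proof. intros H; now apply (proj1 (Forall_forall _ _) H). Qed.

Lemma state_le_refl L : nonneg L -> state_le L L.
Proof. induction 1; constructor; auto. Qed.

Lemma state_le_weight L L' : state_le L L' -> weight L = weight L'.
Proof.
  induction 1 as [|p q L L' [H _] _ IH]; [reflexivity|].
  unfold weight in *; rewrite !lsum_cons; lra.
Qed.

Lemma alive_bounds L : 0 <= alive L <= 1.
Proof. unfold alive; destruct forallb; lra. Qed.

Lemma alive_le L L' : (forallb (fun p => 0 <? snd p)%nat L = true ->
  forallb (fun p => 0 <? snd p)%nat L' = true) -> alive L <= alive L'.
Proof.
  unfold alive; destruct forallb; intros H; [rewrite H by auto; lra|destruct forallb; lra].
Qed.

Lemma alive_mono L L' : state_le L L' -> alive L <= alive L'.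
Proof.
  intros H; apply alive_le; induction H as [|p q L L' [_ [_ H]] _ IH]; [auto|].
  simpl; rewrite !Bool.andb_true_iff, !Nat.ltb_lt; intros [? ?]; split; [lia|auto].
Qed.

Lemma surv_mono r : forall L L', state_le L L' -> 0 < weight L -> surv r L <= surv r L'.
Proof.
  induction r as [|r IH]; intros L L' H W; [now apply alive_mono|].
  simpl; rewrite <- (state_le_weight _ _ H); apply Rmult_le_compat_r.
  { left; now apply Rinv_0_lt_compat. }
  apply lsum_Forall2_le with (2 := H); intros p q Hp (E & P & Q).
  rewrite <- E; apply Rmult_le_compat_l; [assumption|]; apply IH.
  - apply Forall2_app; [assumption|]; constructor; [|constructor]; simpl; split; [auto|split;[lra|lia]].
  - rewrite weight_child; lra.
Qed.

Lemma surv_bounds r : forall L, nonneg L -> 0 < weight L -> 0 <= surv r L <= 1.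
Proof.
  induction r as [|r IH]; intros L H W; [apply alive_bounds|].
  assert (I : forall p, In p L -> 0 <= surv r (L ++ [child p]) <= 1).
  { intros p Hp; apply IH; [now apply nonneg_child|rewrite weight_child; lra]. }
  simpl; split.
  - apply Rdiv_le_0_compat; [|assumption]; apply lsum_ge_0; intros p Hp.
    apply Rmult_le_pos; [now apply nonneg_in with L|now apply I].
  - apply Rle_div_l; [assumption|]; rewrite Rmult_1_l; apply lsum_le; intros p Hp.
    pose proof (I p Hp); pose proof (nonneg_in _ _ H Hp); nra.
Qed.

Lemma surv_decr r : forall L, nonneg L -> 0 < weight L -> surv (S r) L <= surv r L.
Proof.
  induction r as [|r IH]; intros L H W.
  - simpl; apply Rle_div_l; [assumption|]; unfold weight; rewrite <- lsum_scal.
    apply lsum_le; intros p Hp; rewrite (Rmult_comm (alive L)).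
    apply Rmult_le_compat_l; [now apply nonneg_in with L|].
    apply alive_le; rewrite forallb_app, Bool.andb_true_iff; tauto.
  - change (lsum (fun p => fst p * surv (S r) (L ++ [child p])) L / weight L
            <= lsum (fun p => fst p * surv r (L ++ [child p])) L / weight L).
    apply Rmult_le_compat_r; [left; now apply Rinv_0_lt_compat|].
    apply lsum_le; intros p Hp; apply Rmult_le_compat_l; [now apply nonneg_in with L|].
    apply IH; [now apply nonneg_child|rewrite weight_child; lra].
Qed.

(* A heavier root attracts more children, and those are the shallowest ones. *)
Lemma surv_root_mono r c th th' : 0 <= th <= th' -> forall N : state, nonneg N ->
  Forall (fun p => (snd p <= c)%nat) N -> 0 < th + weight N ->
  surv r ((th, c) :: N) <= surv r ((th', c) :: N).
Proof.
  intros Hth; induction r as [|r IH]; intros N HN HC W; [apply Rle_refl|].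
  assert (W0 : 0 <= weight N) by (apply lsum_ge_0; intros p; now apply nonneg_in).
  assert (E : forall t, weight ((t, c) :: N) = t + weight N) by reflexivity.
  cbn [surv]; rewrite !E, !lsum_cons; cbn [fst app].
  assert (I : forall p, In p N \/ snd p = c -> surv r ((th, c) :: N ++ [child p])
      <= surv r ((th', c) :: N ++ [child p])).
  { intros p Hp; apply IH.
    - now apply nonneg_child.
    - apply Forall_app; split; [assumption|]; constructor; [|constructor].
      simpl; destruct Hp as [Hp|Hp]; [|lia].
      apply (proj1 (Forall_forall _ _) HC) in Hp; lia.
    - rewrite weight_child; lra. }
  set (X := surv r ((th, c) :: N ++ [child (th, c)])).
  set (S1 := lsum (fun p => fst p * surv r ((th, c) :: N ++ [child p])) N).
  set (X' := surv r ((th', c) :: N ++ [child (th', c)])).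
  set (S2 := lsum (fun p => fst p * surv r ((th', c) :: N ++ [child p])) N).
  assert (HX : X <= X') by (apply (I (th, c)); now right).
  assert (HS : S1 <= S2).
  { apply lsum_le; intros p Hp; apply Rmult_le_compat_l; [now apply nonneg_in with N|].
    apply I; now left. }
  (* No insertion leaves more capacity than a child of the root, so [X] dominates the average over
     the other parents. *)
  assert (HSX : S1 <= weight N * X).
  { unfold S1, weight; rewrite Rmult_comm, <- lsum_scal; apply lsum_le; intros p Hp.
    rewrite Rmult_comm; apply Rmult_le_compat_r; [now apply nonneg_in with N|].
    apply surv_mono; [|cbn [app]; unfold weight; rewrite lsum_cons, lsum_app; simpl;
      unfold lsum at 2; simpl; fold (weight N); lra].
    constructor; [simpl; repeat split; auto; lra|].
    apply Forall2_app; [now apply state_le_refl|]; constructor; [|constructor].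
    simpl; repeat split; [lra|]; apply (proj1 (Forall_forall _ _) HC) in Hp; lia. }
  (* The weight changes first in the choice of this parent alone, then in all later insertions. *)
  apply Rle_trans with ((th' * X + S1) / (th' + weight N)).
  - apply Rle_div_l; [assumption|].
    replace ((th' * X + S1) / (th' + weight N) * (th + weight N))
      with ((th' * X + S1) * (th + weight N) / (th' + weight N)) by (field; lra).
    apply Rle_div_r; [lra|]; nra.
  - apply Rmult_le_compat_r; [left; apply Rinv_0_lt_compat; lra|]; nra.
Qed.

(** This is [W (W + 1) ... (W + r - 1) / r!], the coefficient of [x ^ r] in [(1 - x) ^ (- W)]: the
    value of [coef] for a state that cannot die. *)
Fixpoint rising (W : R) (r : nat) : R :=
  match r with
  | O => 1
  | S r' => W * rising (W + 1) r' / INR (S r')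
  end.

Lemma rising_succ r : forall W, rising W (S r) = rising W r * (W + INR r) / INR (S r).
Proof.
  induction r as [|r IH]; intros W.
  - simpl; lra.
  - change (rising W (S (S r))) with (W * rising (W + 1) (S r) / INR (S (S r))).
    rewrite IH; change (rising W (S r)) with (W * rising (W + 1) r / INR (S r)).
    rewrite !S_INR; pose proof (pos_INR r); field; lra.
Qed.

Lemma rising_1 r : rising 1 r = 1.
Proof.
  induction r as [|r IH]; [reflexivity|]; rewrite rising_succ, IH, S_INR.
  pose proof (pos_INR r); field; lra.
Qed.

Lemma rising_pos W r : 0 < W -> 0 < rising W r.
Proof.
  intros H; induction r as [|r IH]; [simpl; lra|]; rewrite rising_succ, S_INR.
  pose proof (pos_INR r); apply Rdiv_lt_0_compat; nra.
Qed.

Lemma rising_incr W r : 1 <= W -> rising W r <= rising W (S r).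
Proof.
  intros H; rewrite rising_succ, S_INR; pose proof (pos_INR r).
  pose proof (rising_pos W r ltac:(lra)); apply Rle_div_r; nra.
Qed.

(* With this normalisation, the coefficients of a union of states are a Cauchy product. *)
Fixpoint coef (r : nat) (L : state) : R :=
  match r with
  | O => alive L
  | S r' => lsum (fun p => fst p * coef r' (L ++ [child p])) L / INR (S r')
  end.

Lemma coef_surv r : forall L, nonneg L -> 0 < weight L ->
  coef r L = surv r L * rising (weight L) r.
Proof.
  induction r as [|r IH]; intros L H W; [simpl; lra|].
  cbn [coef surv rising].
  rewrite (lsum_ext _ (fun p => rising (weight L + 1) r * (fst p * surv r (L ++ [child p])))).
  - rewrite lsum_scal, S_INR; pose proof (pos_INR r); field; lra.
  - intros p Hp; rewrite IH, weight_child; [lra|now apply nonneg_child|rewrite weight_child; lra].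
Qed.

Lemma alive_perm L L' : Permutation L L' -> alive L = alive L'.
Proof.
  intros H; apply Rle_antisym; apply alive_le; rewrite !forallb_forall; intros I p Hp; apply I;
    [apply Permutation_in with (2 := Hp); now symmetry|now apply Permutation_in with (2 := Hp)].
Qed.

Lemma coef_perm r : forall L L', Permutation L L' -> coef r L = coef r L'.
Proof.
  induction r as [|r IH]; intros L L' H; [now apply alive_perm|].
  cbn [coef]; f_equal; rewrite (lsum_perm _ _ _ H); apply lsum_ext; intros p _.
  f_equal; apply IH; now apply Permutation_app_tail.
Qed.

(** * Product rule for coefficient sequences *)

Lemma PS_mult_scal_l c a b n : PS_mult (fun i => c * a i) b n = c * PS_mult a b n.
Proof.
  unfold PS_mult; rewrite scal_sum; apply sum_eq; intros; ring.
Qed.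

Lemma PS_mult_scal_r c a b n : PS_mult a (fun i => c * b i) n = c * PS_mult a b n.
Proof.
  unfold PS_mult; rewrite scal_sum; apply sum_eq; intros; ring.
Qed.

Lemma PS_mult_lsum_l {A} (F : A -> nat -> R) b n (l : list A) :
  PS_mult (fun i => lsum (fun p => F p i) l) b n = lsum (fun p => PS_mult (F p) b n) l.
Proof.
  induction l as [|p l IH].
  - unfold lsum; simpl; unfold PS_mult; apply sum_eq_R0; intros; ring.
  - rewrite lsum_cons, <- IH; unfold PS_mult; rewrite <- plus_sum.
    apply sum_eq; intros; rewrite lsum_cons; ring.
Qed.

Lemma PS_mult_lsum_r {A} (F : A -> nat -> R) a n (l : list A) :
  PS_mult a (fun i => lsum (fun p => F p i) l) n = lsum (fun p => PS_mult a (F p) n) l.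
Proof.
  induction l as [|p l IH].
  - unfold lsum; simpl; unfold PS_mult; apply sum_eq_R0; intros; ring.
  - rewrite lsum_cons, <- IH; unfold PS_mult; rewrite <- plus_sum.
    apply sum_eq; intros; rewrite lsum_cons; ring.
Qed.

Lemma PS_derive_mult a b n :
  PS_derive (PS_mult a b) n = PS_mult (PS_derive a) b n + PS_mult a (PS_derive b) n.
Proof.
  unfold PS_derive, PS_mult; rewrite scal_sum.
  rewrite (sum_eq _ (fun k => INR k * a k * b (S n - k)%nat
                              + a k * (INR (S n - k) * b (S n - k)%nat))).
  2:{ intros i Hi; rewrite minus_INR by assumption; ring. }
  rewrite plus_sum; f_equal.
  - rewrite decomp_sum by lia; simpl pred.
    replace (INR 0 * a O * b (S n - 0)%nat) with 0 by (simpl; ring).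
    rewrite Rplus_0_l; apply sum_eq; intros i Hi; reflexivity.
  - rewrite tech5, Nat.sub_diag; simpl (INR 0); rewrite Rmult_0_l, Rmult_0_r, Rplus_0_r.
    apply sum_eq; intros i Hi; replace (S n - i)%nat with (S (n - i)) by lia; reflexivity.
Qed.

Lemma PS_derive_coef L n :
  PS_derive (fun r => coef r L) n = lsum (fun p => fst p * coef n (L ++ [child p])) L.
Proof.
  unfold PS_derive; cbn [coef]; rewrite S_INR; pose proof (pos_INR n); field; lra.
Qed.

Lemma alive_app L1 L2 : alive (L1 ++ L2) = alive L1 * alive L2.
Proof.
  unfold alive; rewrite forallb_app; destruct forallb; destruct forallb; simpl; lra.
Qed.

Lemma PS_mult_ext a a' b b' n :
  (forall i, a i = a' i) -> (forall i, b i = b' i) -> PS_mult a b n = PS_mult a' b' n.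
Proof. intros H H'; apply sum_eq; intros; now rewrite H, H'. Qed.

(** Insertions into one part leave the other alone, so the two growth histories interleave freely;
    the factor [1 / r!] hidden in [coef] absorbs the number of interleavings. Formally both sides
    have the same derivative: peel off the first insertion on the left, use the Leibniz rule on the
    right. *)
Lemma coef_app r : forall L1 L2,
  coef r (L1 ++ L2) = PS_mult (fun i => coef i L1) (fun i => coef i L2) r.
Proof.
  induction r as [|r IH]; intros L1 L2.
  - apply alive_app.
  - apply Rmult_eq_reg_l with (INR (S r)); [|apply not_0_INR; lia].
    fold (PS_derive (fun i => coef i (L1 ++ L2)) r).
    fold (PS_derive (PS_mult (fun i => coef i L1) (fun i => coef i L2)) r).
    rewrite PS_derive_mult, PS_derive_coef, lsum_app; f_equal.
    + rewrite (PS_mult_ext (PS_derive _) _ _ _ r (PS_derive_coef L1) (fun i => eq_refl)).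
      rewrite PS_mult_lsum_l; apply lsum_ext; intros p _; rewrite PS_mult_scal_l; f_equal.
      rewrite <- IH; apply coef_perm; rewrite <- !app_assoc; apply Permutation_app_head.
      apply Permutation_app_comm.
    + rewrite (PS_mult_ext _ _ (PS_derive _) _ r (fun i => eq_refl) (PS_derive_coef L2)).
      rewrite PS_mult_lsum_r; apply lsum_ext; intros p _; rewrite PS_mult_scal_r; f_equal.
      now rewrite <- IH, app_assoc.
Qed.

(** * Random recursive trees and the comparison of Hoppe trees with them *)

(* The probability that a random recursive tree with [n + 1] nodes has height less than [c]. *)
Definition rrt (c n : nat) : R := surv n [(1, c)].

Lemma nonneg_single w c : 0 <= w -> nonneg [(w, c)].
Proof. intros; constructor; [assumption|constructor]. Qed.

Lemma weight_single w c : weight [(w, c)] = w.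
Proof. unfold weight, lsum; simpl; lra. Qed.

Lemma rrt_coef c n : rrt c n = coef n [(1, c)].
Proof.
  rewrite coef_surv, weight_single, rising_1, Rmult_1_r; [reflexivity|..].
  - apply nonneg_single; lra.
  - rewrite weight_single; lra.
Qed.

(** After the first insertion the subtree of the new node and the rest of the tree grow as two
    random recursive trees, of capacities [c - 1] and [c]. This is [f_c' = f_c f_(c-1)],
    coefficientwise. *)
Lemma rrt_derive c n : PS_derive (rrt c) n = PS_mult (rrt c) (rrt (pred c)) n.
Proof.
  unfold PS_derive; rewrite rrt_coef.
  fold (PS_derive (fun n => coef n [(1, c)]) n); rewrite PS_derive_coef.
  unfold lsum; cbn [map fold_right fst]; rewrite Rmult_1_l, Rplus_0_r, coef_app.
  apply PS_mult_ext; intros i; now rewrite rrt_coef.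
Qed.

Lemma rrt_bounds c n : 0 <= rrt c n <= 1.
Proof.
  apply surv_bounds; [apply nonneg_single; lra|rewrite weight_single; lra].
Qed.

Lemma rrt_decr c n : rrt c (S n) <= rrt c n.
Proof.
  apply surv_decr; [apply nonneg_single; lra|rewrite weight_single; lra].
Qed.

(** The first insertion is forced. Lowering the root weight to 0 then only hurts survival, and it
    sends all further nodes into the subtree of the first child, a random recursive tree of capacity
    [c]. *)
Lemma hoppe_lower_bound th c n : 0 < th -> rrt c n <= surv (S n) [(th, S c)].
Proof.
  intros H.
  replace (surv (S n) [(th, S c)]) with (surv n [(th, S c); (1, c)]).
  2:{ cbn [surv]; rewrite weight_single; unfold lsum; simpl; unfold child; simpl; field; lra. }
  apply Rle_trans with (surv n [(0, S c); (1, c)]).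
  - clear th H. unfold rrt.
    (* An entry of weight 0 is never chosen as a parent. [N] is general because it grows along the
       induction. *)
    cut (forall N : state, nonneg N -> 0 < weight N -> surv n N <= surv n ((0, S c) :: N)).
    { intros I; apply I; [apply nonneg_single; lra|rewrite weight_single; lra]. }
    induction n as [|n IH]; intros N H W.
    + apply alive_le; simpl; auto.
    + cbn [surv]; rewrite lsum_cons; cbn [fst app].
      replace (weight ((0, S c) :: N)) with (weight N) by (unfold weight; rewrite lsum_cons; simpl; lra).
      apply Rmult_le_compat_r; [left; now apply Rinv_0_lt_compat|].
      rewrite Rmult_0_l, Rplus_0_l; apply lsum_le; intros p Hp.
      apply Rmult_le_compat_l; [now apply nonneg_in with N|].
      apply IH; [now apply nonneg_child|rewrite weight_child; lra].
  - apply surv_root_mono; [lra|apply nonneg_single; lra| |rewrite weight_single; lra].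
    constructor; [simpl; lia|constructor].
Qed.

(** After the forced first insertion, [coef_app] separates the root from the subtree of its first
    child. Survival of the root part is bounded by 1. Raising the weight to [t >= 1] makes
    [rising t] nondecreasing, so it leaves the convolution at its value for [n]. *)
Lemma hoppe_upper_bound th c n : 0 < th ->
  surv (S n) [(th, S c)] <= Rmax th 1 / INR (S n) * sum_f_R0 (rrt c) n.
Proof.
  intros H; set (t := Rmax th 1).
  assert (Ht : th <= t) by apply Rmax_l; assert (Ht1 : 1 <= t) by apply Rmax_r.
  apply Rle_trans with (surv (S n) [(t, S c)]).
  { apply surv_root_mono; [lra|constructor|constructor|unfold weight, lsum; simpl; lra]. }
  assert (N1 : forall d, nonneg [(t, d)]) by (intros; apply nonneg_single; lra).
  assert (W1 : forall d, 0 < weight [(t, d)]) by (intros; rewrite weight_single; lra).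
  assert (E := coef_surv (S n) [(t, S c)] (N1 _) (W1 _)); rewrite weight_single in E.
  assert (P := rising_pos t (S n) ltac:(lra)).
  apply Rmult_le_reg_r with (rising t (S n)); [assumption|]; rewrite <- E.
  cbn [coef]; unfold lsum; cbn [map fold_right fst]; rewrite Rplus_0_r, coef_app.
  unfold child; cbn [snd pred].
  rewrite rising_succ, S_INR; pose proof (pos_INR n) as Hn; pose proof (rising_pos t n ltac:(lra)).
  assert (PS_mult (fun i => coef i [(t, S c)]) (fun i => coef i [(1, c)]) n
     <= rising t n * sum_f_R0 (rrt c) n).
  { unfold PS_mult.
    rewrite <- (sum_f_R0_skip (rrt c)), scal_sum; apply sum_Rle; intros i Hi.
    rewrite <- rrt_coef, coef_surv, weight_single by auto.
    rewrite Rmult_comm; apply Rmult_le_compat_l; [apply rrt_bounds|].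
    pose proof (surv_bounds i [(t, S c)] (N1 _) (W1 _)).
    pose proof (rising_pos t i ltac:(lra)).
    assert (rising t i <= rising t n).
    { clear - Hi Ht1; induction Hi as [|m Hm IH]; [lra|].
      pose proof (rising_incr t m Ht1); lra. }
    nra. }
  pose proof (cond_pos_sum (rrt c) n (fun i => proj1 (rrt_bounds c i))) as Hs.
  replace (t / (INR n + 1) * sum_f_R0 (rrt c) n * (rising t n * (t + INR n) / (INR n + 1)))
    with (t * (rising t n * sum_f_R0 (rrt c) n) * ((t + INR n) / (INR n + 1)) / (INR n + 1)) by (field; lra).
  apply Rmult_le_compat_r; [left; apply Rinv_0_lt_compat; lra|].
  assert (1 <= (t + INR n) / (INR n + 1)) by (apply Rle_div_r; lra).
  assert (0 <= t * (rising t n * sum_f_R0 (rrt c) n)) by (repeat apply Rmult_le_pos; lra).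
  apply Rle_trans with (t * (rising t n * sum_f_R0 (rrt c) n)); [apply Rmult_le_compat_l; lra|nra].
Qed.

(** * Comparison of consecutive levels *)

(** If [D x < 0], let [s] be the last point before [x] with [D s >= 0]. In between [D] is negative,
    so [D'] is nonnegative there, and the mean value theorem gives the contradiction
    [D x >= D s]. *)
Lemma nonneg_of_barrier (D D' : R -> R) :
  (forall x, 0 <= x < 1 -> is_derive D x (D' x)) -> 0 <= D 0 ->
  (forall x, 0 <= x < 1 -> D x < 0 -> 0 <= D' x) ->
  forall x, 0 <= x < 1 -> 0 <= D x.
Proof.
  intros HD H0 HB x Hx.
  destruct (Rle_or_lt 0 (D x)) as [|Hneg]; [assumption|exfalso].
  set (E := fun y => 0 <= y <= x /\ 0 <= D y).
  destruct (completeness E) as [s [Hub Hlub]].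
  { exists x; intros y [? _]; lra. }
  { exists 0; split; [lra|assumption]. }
  assert (Hs : 0 <= s <= x).
  { split; [apply Hub; split; [lra|assumption]|apply Hlub; intros y [? _]; lra]. }
  assert (L : forall y, 0 <= y < 1 -> derivable_pt_lim D y (D' y)).
  { intros y Hy; apply is_derive_Reals; auto. }
  assert (C : forall y, 0 <= y < 1 -> continuity_pt D y).
  { intros y Hy; apply derivable_continuous_pt; exists (D' y); now apply L. }
  assert (Ds : 0 <= D s).
  { destruct (Rle_or_lt 0 (D s)) as [|Hn]; [assumption|exfalso].
    destruct (C s ltac:(lra) (- D s) ltac:(lra)) as (d & Hd & Hc).
    assert (s <= s - d / 2); [|lra].
    apply Hlub; intros y [Hy Dy].
    destruct (Rle_or_lt y (s - d / 2)) as [|Hlt]; [assumption|exfalso].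
    assert (y <= s) by (apply Hub; split; assumption).
    destruct (Req_dec y s) as [->|Hne]; [lra|].
    specialize (Hc y); simpl in Hc; unfold R_dist, D_x, no_cond in Hc.
    assert (Rabs (D y - D s) < - D s).
    { apply Hc; repeat split; auto; rewrite Rabs_left1; lra. }
    apply Rabs_def2 in H1; lra. }
  assert (Hlt : s < x) by (destruct (Req_dec s x) as [->|]; lra).
  destruct (MVT_cor2 D D' s x Hlt) as (z & Heq & Hz).
  { intros y Hy; apply L; lra. }
  assert (D z < 0).
  { destruct (Rle_or_lt 0 (D z)) as [Hp|]; [|assumption].
    assert (z <= s) by (apply Hub; split; [lra|assumption]); lra. }
  pose proof (HB z ltac:(lra) H); nra.
Qed.

(** The alternatives are what [low_step] needs when it uses [high_step] or its induction hypothesis,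
    respectively. Both right-hand sides increase with [U], so only [U = (7 u + u^3) / 8] has to be
    checked; 82/100 is a point where both hold. *)
Lemma cubic_barrier u U : 0 <= u <= 1 -> 0 <= U <= 1 -> (7 * u + u ^ 3) / 8 <= U ->
  u * (7 + 3 * u ^ 2) <= 12 * U ^ 2 \/ u * (7 + 3 * u ^ 2) <= U * (8 + U + U ^ 2).
Proof.
  intros Hu HU HT; destruct (Rle_or_lt u (82 / 100)) as [H|H]; [right|left].
  - set (T := (7 * u + u ^ 3) / 8) in *.
    assert (0 <= T) by (pose proof (pow_le u 3 (proj1 Hu)); unfold T; lra).
    apply Rle_trans with (T * (8 + T + T ^ 2)).
    2:{ assert (T ^ 2 <= U ^ 2) by (apply pow_incr; lra).
        pose proof (pow2_ge_0 T); apply Rmult_le_compat; lra. }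
    unfold T.
    (* [T (8 + T + T^2) - u (7 + 3 u^2)] is [u^2 / 8] times this polynomial. The powers 2 to 5 of
       [u] are bounded below by their tangents at [a], the seventh by 0. *)
    assert (Q : 0 <= (7 + u ^ 2) ^ 2 / 8 + u * (7 + u ^ 2) ^ 3 / 64 - 16 * u).
    { set (a := 82 / 100) in *.
      assert (0 <= (u - a) ^ 2) by apply pow2_ge_0.
      assert (0 <= (u - a) ^ 2 * (u + 2 * a)) by (apply Rmult_le_pos; [assumption|unfold a; lra]).
      assert (0 <= (u - a) ^ 2 * (u ^ 2 + 2 * a * u + 3 * a ^ 2))
        by (apply Rmult_le_pos; [assumption|unfold a; nra]).
      assert (0 <= (u - a) ^ 2 * (u ^ 3 + 2 * a * u ^ 2 + 3 * a ^ 2 * u + 4 * a ^ 3)).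
      { pose proof (pow_le u 3 (proj1 Hu)); pose proof (pow_le u 2 (proj1 Hu)).
        apply Rmult_le_pos; [assumption|unfold a; lra]. }
      pose proof (pow_le u 7 (proj1 Hu)).
      unfold a in *; lra. }
    assert (0 <= u / 8 * (u * ((7 + u ^ 2) ^ 2 / 8 + u * (7 + u ^ 2) ^ 3 / 64 - 16 * u)))
      by (repeat apply Rmult_le_pos; lra).
    lra.
  - apply Rle_trans with (12 * ((7 * u + u ^ 3) / 8) ^ 2).
    2:{ apply Rmult_le_compat_l; [lra|]; apply pow_incr; split; [|assumption].
        pose proof (pow_le u 3 (proj1 Hu)); lra. }
    (* A factor [u / 16] is split off. The square is bounded above by its chord on [[82/100, 1]],
       the cube below by its tangent, the fifth power by its value at the left endpoint. *)
    assert (0 <= 3 * u * (7 + u ^ 2) ^ 2 - 16 * (7 + 3 * u ^ 2)).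
    { assert (0 <= (u - 82 / 100) * (1 - u)) by (apply Rmult_le_pos; lra).
      assert (0 <= (u - 82 / 100) ^ 2 * (u + 2 * (82 / 100)))
        by (apply Rmult_le_pos; [apply pow2_ge_0|lra]).
      assert ((82 / 100) ^ 5 <= u ^ 5) by (apply pow_incr; lra).
      lra. }
    assert (0 <= u / 16 * (3 * u * (7 + u ^ 2) ^ 2 - 16 * (7 + 3 * u ^ 2))) by (apply Rmult_le_pos; lra).
    lra.
Qed.

(** * Generating functions and their differential system *)

Definition gf (c : nat) (x : R) : R := PSeries (rrt c) x.

Lemma rrt_radius c x : Rabs x < 1 -> Rbar_lt (Rabs x) (CV_radius (rrt c)).
Proof.
  intros H; apply Rbar_lt_le_trans with 1; [exact H|].
  apply (proj1 (CV_radius_bounded (rrt c))); exists 1; intros n.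
  rewrite pow1, Rmult_1_r, Rabs_pos_eq; apply rrt_bounds.
Qed.

Lemma rrt_0 n : rrt 0 n = 0.
Proof.
  apply Rle_antisym; [|apply rrt_bounds].
  induction n as [|n IH]; [apply Rle_refl|]; eapply Rle_trans; [apply rrt_decr|exact IH].
Qed.

Lemma gf_derive c x : Rabs x < 1 -> is_derive (gf c) x (gf c x * gf (pred c) x).
Proof.
  intros H; unfold gf; rewrite <- PSeries_mult by now apply rrt_radius.
  rewrite <- (PSeries_ext _ _ x (rrt_derive c)).
  now apply is_derive_PSeries, rrt_radius.
Qed.

Lemma ex_series_rrt c x : Rabs x < 1 -> ex_series (fun i => rrt c i * x ^ i).
Proof.
  intros H; apply (proj1 (ex_pseries_R _ _)), CV_radius_inside; now apply rrt_radius.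
Qed.

Lemma gf_Series c x : gf c x = Series (fun i => rrt c i * x ^ i).
Proof. reflexivity. Qed.

Lemma gf_bounds c x : 0 <= x < 1 -> 0 <= (1 - x) * gf c x <= 1.
Proof.
  intros H; assert (Hx : Rabs x < 1) by (rewrite Rabs_pos_eq; lra).
  rewrite gf_Series.
  assert (T : forall n, 0 <= rrt c n * x ^ n <= x ^ n).
  { intros n; pose proof (pow_le x n (proj1 H)); pose proof (rrt_bounds c n); nra. }
  split.
  - apply Rmult_le_pos; [lra|].
    rewrite <- (Rmult_0_l (Series (fun i => rrt c i * x ^ i))), <- Series_scal_l.
    apply Series_le; [|now apply ex_series_rrt].
    intros n; specialize (T n); lra.
  - apply Rle_trans with ((1 - x) * / (1 - x)); [|rewrite Rinv_r; lra].
    apply Rmult_le_compat_l; [lra|].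
    rewrite <- (is_series_unique _ _ (is_series_geom x Hx)).
    apply Series_le; [exact T|]; eexists; now apply is_series_geom.
Qed.

Lemma gf_0 x : gf 0 x = 0.
Proof.
  rewrite gf_Series, (Series_ext _ (fun i => 0 * 0)).
  - rewrite Series_scal_l; ring.
  - intros i; rewrite rrt_0; ring.
Qed.

Lemma gf_at_0 c : gf (S c) 0 = 1.
Proof. unfold gf; now rewrite PSeries_0. Qed.

(* [low c x] is the probability of a height less than [c] when the number of nodes of
   the tree is geometric with parameter [1 - x]. *)
Definition low (c : nat) (x : R) : R := (1 - x) * gf c x.

(** [gf c x] stands for [low c x / (1 - x)]; the barrier arguments multiply by [1 - x], which turns
    every term into values of [low]. *)
Lemma low_derive c x : 0 <= x < 1 -> is_derive (low c) x (- (gf c x * (1 - low (pred c) x))).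
Proof.
  intros H; unfold low.
  assert (G := gf_derive c x ltac:(rewrite Rabs_pos_eq; lra)).
  auto_derive; [now exists (gf c x * gf (pred c) x)|].
  assert (E : Derive (fun y : R => gf c y) x = gf c x * gf (pred c) x)
    by now apply is_derive_unique.
  rewrite E; ring.
Qed.

Lemma low_bounds c x : 0 <= x < 1 -> 0 <= low c x <= 1.
Proof. apply gf_bounds. Qed.

Lemma low_0 x : low 0 x = 0.
Proof. unfold low; rewrite gf_0; ring. Qed.

Lemma low_at_0 c : low (S c) 0 = 1.
Proof. unfold low; rewrite gf_at_0; ring. Qed.

(** Induction on [c], each step a barrier argument starting at [x = 0]. The derivative of the
    difference involves [1 - low c x], which the induction hypothesis bounds from below. *)
Lemma high_step c : forall x, 0 <= x < 1 ->
  3 / 2 * (1 - low (S c) x) * low (S c) x <= 1 - low c x.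
Proof.
  induction c as [|c IH]; intros x Hx.
  - rewrite low_0; pose proof (low_bounds 1 x Hx).
    pose proof (pow2_ge_0 (low 1 x - 1 / 2)); lra.
  - set (v := fun c x => 1 - low c x).
    cut (0 <= v (S c) x - 3 / 2 * (v (S (S c)) x - (v (S (S c)) x) ^ 2)); [unfold v; lra|].
    apply (nonneg_of_barrier (fun x => v (S c) x - 3 / 2 * (v (S (S c)) x - (v (S (S c)) x) ^ 2))
      (fun x => gf (S c) x * v c x
        - 3 / 2 * (gf (S (S c)) x * v (S c) x * (1 - 2 * v (S (S c)) x)))); [| | |assumption].
    + clear x Hx; intros x Hx; unfold v.
      assert (E1 : Derive (fun y : R => low (S c) y) x = _)
        by exact (is_derive_unique _ _ _ (low_derive (S c) x Hx)).
      assert (E2 : Derive (fun y : R => low (S (S c)) y) x = _)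
        by exact (is_derive_unique _ _ _ (low_derive (S (S c)) x Hx)).
      auto_derive.
      * repeat split; eexists; now apply low_derive.
      * simpl pred in E1, E2; rewrite E1, E2; ring.
    + unfold v; rewrite !low_at_0; lra.
    + clear x Hx; intros x Hx; specialize (IH x Hx).
      pose proof (low_bounds (S c) x Hx); pose proof (low_bounds (S (S c)) x Hx).
      unfold v; intros HD.
      set (U := low (S c) x) in *; set (u := low (S (S c)) x) in *.
      apply Rmult_le_reg_l with (1 - x); [lra|]; rewrite Rmult_0_r.
      replace ((1 - x) * _) with (U * (1 - low c x) - 3 / 2 * (u * (1 - U) * (1 - 2 * (1 - u))))
        by (unfold U, u, low; ring).
      apply Rle_trans with (3 / 2 * (1 - U) * (U ^ 2 - u * (2 * u - 1))).
      * apply Rmult_le_pos; [lra|].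
        (* Where the claim fails, [U] exceeds [1 - 3/2 u (1 - u)]. The square of this bound minus
           [u (2 u - 1)] is [(1 - u)^2 + 9/4 u^2 (1 - u)^2]; the constant 3/2 produces this sum of
           squares. *)
        assert (W : (1 - 3 / 2 * (u * (1 - u))) ^ 2 <= U ^ 2).
        { pose proof (pow2_ge_0 (u - 1 / 2)); apply pow_incr; lra. }
        pose proof (pow2_ge_0 (1 - u)); pose proof (pow2_ge_0 (u * (1 - u))); lra.
      * apply (Rmult_le_compat_l U) in IH; [|lra]; lra.
Qed.

Lemma low_step c : forall x, 0 <= x < 1 ->
  low c x <= (7 * low (S c) x + low (S c) x ^ 3) / 8.
Proof.
  induction c as [|c IH]; intros x Hx.
  - rewrite low_0; pose proof (low_bounds 1 x Hx); pose proof (pow_le (low 1 x) 3); lra.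
  - cut (0 <= (7 * low (S (S c)) x + low (S (S c)) x ^ 3) / 8 - low (S c) x); [lra|].
    apply (nonneg_of_barrier (fun x => (7 * low (S (S c)) x + low (S (S c)) x ^ 3) / 8 - low (S c) x)
      (fun x => gf (S c) x * (1 - low c x)
        - gf (S (S c)) x * (1 - low (S c) x) * (7 + 3 * low (S (S c)) x ^ 2) / 8));
      [| | |assumption].
    + clear x Hx; intros x Hx.
      assert (E1 : Derive (fun y : R => low (S c) y) x = _)
        by exact (is_derive_unique _ _ _ (low_derive (S c) x Hx)).
      assert (E2 : Derive (fun y : R => low (S (S c)) y) x = _)
        by exact (is_derive_unique _ _ _ (low_derive (S (S c)) x Hx)).
      auto_derive.
      * repeat split; eexists; now apply low_derive.
      * simpl pred in E1, E2; rewrite E1, E2; field.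
    + rewrite !low_at_0; lra.
    + clear x Hx; intros x Hx HD; specialize (IH x Hx); pose proof (high_step c x Hx) as A.
      pose proof (low_bounds (S c) x Hx); pose proof (low_bounds (S (S c)) x Hx).
      set (U := low (S c) x) in *; set (u := low (S (S c)) x) in *.
      apply Rmult_le_reg_l with (1 - x); [lra|]; rewrite Rmult_0_r.
      replace ((1 - x) * _) with (U * (1 - low c x) - u * (1 - U) * (7 + 3 * u ^ 2) / 8)
        by (unfold U, u, low; field).
      (* In the first case [1 - low c x] is bounded below by [high_step], in the second by the
         induction hypothesis, as [1 - (7 U + U^3) / 8 = (1 - U) (8 + U + U^2) / 8]. *)
      destruct (cubic_barrier u U ltac:(lra) ltac:(lra) ltac:(lra)) as [B|B].
      * apply (Rmult_le_compat_l (1 - U)) in B; [|lra].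
        apply (Rmult_le_compat_l U) in A; [|lra]; lra.
      * apply (Rmult_le_compat_l (1 - U)) in B; [|lra].
        assert (U * ((1 - U) * (8 + U + U ^ 2) / 8) <= U * (1 - low c x))
          by (apply Rmult_le_compat_l; lra).
        lra.
Qed.

(** * From geometric to fixed size *)

(** A geometric index is at least [m] with probability [x ^ m], and then contributes at most [a m];
    otherwise it contributes at most 1. *)
Lemma geom_mean_le m : forall (a : nat -> R) x, 0 <= x < 1 ->
  (forall i, 0 <= a i <= 1) -> (forall i, a (S i) <= a i) ->
  (1 - x) * Series (fun i => a i * x ^ i) <= 1 - x ^ m * (1 - a m).
Proof.
  induction m as [|m IH]; intros a x Hx Ha Hd.
  all: assert (G : ex_series (fun i => x ^ i))
    by (eexists; apply is_series_geom; rewrite Rabs_pos_eq; lra).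
  - apply Rle_trans with ((1 - x) * (a O * / (1 - x))); [|rewrite pow_O; right; field; lra].
    apply Rmult_le_compat_l; [lra|].
    rewrite <- (is_series_unique (fun i => x ^ i) (/ (1 - x)))
      by (apply is_series_geom; rewrite Rabs_pos_eq; lra).
    rewrite <- Series_scal_l.
    apply Series_le; [|exact (ex_series_scal (V := R_NormedModule) (a O) _ G)].
    intros i; assert (a i <= a O) by (induction i as [|i IHi]; [lra|specialize (Hd i); lra]).
    pose proof (pow_le x i (proj1 Hx)); pose proof (Ha i); nra.
  - rewrite Series_incr_1.
    2:{ apply (ex_series_le (K := R_AbsRing) (V := R_CompleteNormedModule)) with (fun i => x ^ i);
        [|assumption].
        intros i; change (Rabs (a i * x ^ i) <= x ^ i).
        pose proof (pow_le x i (proj1 Hx)); pose proof (Ha i).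
        rewrite Rabs_pos_eq; nra. }
    rewrite (Series_ext _ (fun i => x * (a (S i) * x ^ i))) by (intros; simpl; ring).
    rewrite Series_scal_l.
    specialize (IH (fun i => a (S i)) x Hx (fun i => Ha (S i)) (fun i => Hd (S i))); simpl in IH.
    pose proof (Ha O); simpl pow.
    apply (Rmult_le_compat_l x) in IH; [|lra].
    assert ((1 - x) * a O <= 1 - x) by nra. simpl; lra.
Qed.

Lemma sum_le_geom_mean (a : nat -> R) m x : 0 <= x < 1 -> (forall i, 0 <= a i <= 1) ->
  x ^ m * sum_f_R0 a m <= Series (fun i => a i * x ^ i).
Proof.
  intros Hx Ha.
  assert (T : forall i, 0 <= a i * x ^ i <= x ^ i).
  { intros i; pose proof (pow_le x i (proj1 Hx)); pose proof (Ha i); nra. }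
  assert (G : ex_series (fun i => a i * x ^ i)).
  { apply (ex_series_le (K := R_AbsRing) (V := R_CompleteNormedModule)) with (fun i => x ^ i).
    - intros i; change (Rabs (a i * x ^ i) <= x ^ i); rewrite Rabs_pos_eq; apply T.
    - eexists; apply is_series_geom; rewrite Rabs_pos_eq; lra. }
  rewrite (Series_incr_n _ (S m)) by (auto with arith); simpl pred.
  assert (0 <= Series (fun k => a (S m + k)%nat * x ^ (S m + k))).
  { rewrite <- (Rmult_0_l (Series (fun k => a (S m + k)%nat * x ^ (S m + k)))), <- Series_scal_l.
    apply Series_le; [|now apply (ex_series_incr_n (fun i => a i * x ^ i))].
    intros i; specialize (T (S m + i)%nat); lra. }
  apply Rle_trans with (sum_f_R0 (fun i => a i * x ^ i) m); [|lra].
  rewrite scal_sum; apply sum_Rle; intros i Hi; apply Rmult_le_compat_l; [apply Ha|].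
  replace m with (i + (m - i))%nat by lia; rewrite pow_add.
  pose proof (pow_le x i (proj1 Hx)).
  assert (x ^ (m - i) <= 1) by (rewrite <- (pow1 (m - i)); apply pow_incr; lra).
  nra.
Qed.

(* The parameter for which a geometric number of nodes has mean [m + 1]. *)
Definition geo (m : nat) : R := 1 - / INR (S m).

Lemma geo_bounds m : 0 <= geo m < 1.
Proof.
  unfold geo; rewrite S_INR; pose proof (pos_INR m).
  assert (0 < / (INR m + 1)) by (apply Rinv_0_lt_compat; lra).
  assert (/ (INR m + 1) <= 1) by (rewrite <- Rinv_1 at 2; apply Rinv_le_contravar; lra).
  lra.
Qed.

Lemma exp_mult_INR n x : exp (INR n * x) = exp x ^ n.
Proof.
  induction n as [|n IH]; [simpl; rewrite Rmult_0_l; apply exp_0|].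
  rewrite S_INR, Rmult_plus_distr_r, Rmult_1_l, exp_plus, IH; simpl; ring.
Qed.

(** For [m >= 1] the power is [(1 + 1/m)^(-m) >= 1/e >= 1/3]. This is the factor lost between
    geometric and fixed size. *)
Lemma geo_pow m : 1 <= 3 * geo m ^ m.
Proof.
  destruct m as [|m]; [simpl; lra|].
  set (k := INR (S m)); assert (Hk : 0 < k) by (apply lt_0_INR; lia).
  assert (E : geo (S m) = / (1 + / k)).
  { unfold geo; rewrite S_INR; fold k; field; split; lra. }
  rewrite E, pow_inv.
  assert (Hi : 0 < / k) by now apply Rinv_0_lt_compat.
  assert (P : (1 + / k) ^ S m <= 3).
  { apply Rle_trans with (exp (/ k) ^ S m).
    - apply pow_incr; split; [lra|]; apply Rlt_le, exp_ineq1; lra.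
    - rewrite <- exp_mult_INR; fold k; rewrite Rinv_r by lra; apply exp_le_3. }
  assert (0 < (1 + / k) ^ S m) by (apply pow_lt; lra).
  apply (Rmult_le_reg_r ((1 + / k) ^ S m)); [assumption|].
  rewrite Rmult_assoc, Rinv_l by lra; lra.
Qed.

Lemma rrt_tail_le c m : 1 - rrt c m <= 3 * (1 - low c (geo m)).
Proof.
  pose proof (geom_mean_le m (rrt c) (geo m) (geo_bounds m) (rrt_bounds c) (rrt_decr c)) as H.
  unfold low; rewrite gf_Series.
  pose proof (geo_pow m); pose proof (rrt_bounds c m).
  assert (1 * (1 - rrt c m) <= 3 * geo m ^ m * (1 - rrt c m)) by (apply Rmult_le_compat_r; lra).
  lra.
Qed.

Lemma rrt_avg_le c m : sum_f_R0 (rrt c) m / INR (S m) <= 3 * low c (geo m).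
Proof.
  pose proof (sum_le_geom_mean (rrt c) m (geo m) (geo_bounds m) (rrt_bounds c)) as H.
  unfold low; rewrite gf_Series; replace (1 - geo m) with (/ INR (S m)) by (unfold geo; ring).
  unfold Rdiv; rewrite (Rmult_comm _ (/ INR (S m))), <- Rmult_assoc, (Rmult_comm 3), Rmult_assoc.
  apply Rmult_le_compat_l; [left; apply Rinv_0_lt_compat, lt_0_INR; lia|].
  pose proof (geo_pow m).
  assert (0 <= sum_f_R0 (rrt c) m) by (apply cond_pos_sum; intros; apply rrt_bounds).
  assert (1 * sum_f_R0 (rrt c) m <= 3 * geo m ^ m * sum_f_R0 (rrt c) m)
    by (apply Rmult_le_compat_r; assumption).
  lra.
Qed.

Lemma rrt_le_avg c m : rrt c m <= sum_f_R0 (rrt c) m / INR (S m).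
Proof.
  apply Rle_div_r; [apply lt_0_INR; lia|].
  rewrite <- sum_cte; apply sum_Rle; intros i Hi.
  induction Hi as [|m Hm IH]; [lra|]; eapply Rle_trans; [apply rrt_decr|exact IH].
Qed.

(** * Parent lists *)

Lemma parent_lists_length m : forall s, In s (parent_lists m) -> length s = m.
Proof.
  induction m as [|m IH]; intros s H.
  - destruct H as [<-|[]]; reflexivity.
  - cbn [parent_lists] in H; apply in_flat_map in H; destruct H as (s' & Hs & H).
    apply in_map_iff in H; destruct H as (j & <- & _).
    rewrite length_app, (IH s' Hs); simpl; lia.
Qed.

Lemma parent_lists_le m : forall s, In s (parent_lists m) -> forall i, (nth i s 0 <= i)%nat.
Proof.
  induction m as [|m IH]; intros s H i.
  - destruct H as [<-|[]]; destruct i; simpl; lia.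
  - cbn [parent_lists] in H; apply in_flat_map in H; destruct H as (s' & Hs & H).
    apply in_map_iff in H; destruct H as (j & <- & Hj); apply in_seq in Hj.
    pose proof (parent_lists_length m s' Hs) as L.
    destruct (Nat.lt_ge_cases i m) as [Hi|Hi].
    + rewrite app_nth1 by lia; now apply IH.
    + rewrite app_nth2 by lia; destruct (i - length s')%nat as [|[|d]]; simpl; lia.
Qed.

Lemma depth_fuel_enough s : (forall i, (nth i s 0 <= i)%nat) ->
  forall f f' k, (k <= f)%nat -> (k <= f')%nat -> depth_fuel f s k = depth_fuel f' s k.
Proof.
  intros H f; induction f as [|f IH]; intros f' k Hk Hk'.
  - replace k with O by lia; destruct f'; reflexivity.
  - destruct k as [|k]; [destruct f'; reflexivity|].
    destruct f' as [|f']; [lia|]; simpl; f_equal; specialize (H k); apply IH; lia.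
Qed.

Lemma depth_fuel_le s f : forall k, (depth_fuel f s k <= f)%nat.
Proof.
  induction f as [|f IH]; intros [|k]; simpl; try lia; specialize (IH (nth k s 0%nat)); lia.
Qed.

Lemma depth_fuel_app s j : (forall i, (nth i s 0 <= i)%nat) ->
  forall f k, (k <= length s)%nat -> depth_fuel f (s ++ [j]) k = depth_fuel f s k.
Proof.
  intros H f; induction f as [|f IH]; intros [|k] Hk; try reflexivity.
  simpl; rewrite app_nth1 by lia; f_equal; apply IH; specialize (H k); lia.
Qed.

Lemma depth_last s j : (forall i, (nth i s 0 <= i)%nat) -> (j <= length s)%nat ->
  depth (s ++ [j]) (S (length s)) = S (depth s j).
Proof.
  intros H Hj; unfold depth at 1; cbn [depth_fuel].
  rewrite app_nth2, Nat.sub_diag by lia; cbn [nth]; f_equal.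
  rewrite depth_fuel_app by assumption; now apply depth_fuel_enough.
Qed.

(** By truncated subtraction a capacity vanishes exactly when the depth reaches [c], so [alive]
    decides whether the height is below [c]. *)
Definition caps (th : R) (c : nat) (s : list nat) : state :=
  map (fun j => (if Nat.eqb j 0 then th else 1, (c - depth s j)%nat)) (seq 0 (S (length s))).

Lemma caps_snoc th c s j : (forall i, (nth i s 0 <= i)%nat) -> (j <= length s)%nat ->
  caps th c (s ++ [j]) = caps th c s ++ [(1, pred (c - depth s j))].
Proof.
  intros H Hj; unfold caps; rewrite length_app, Nat.add_1_r, seq_S, map_app.
  cbn [map plus Nat.eqb]; f_equal.
  - apply map_ext_in; intros i Hi; apply in_seq in Hi; f_equal.
    unfold depth; rewrite depth_fuel_app by (assumption || lia); reflexivity.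
  - rewrite depth_last by assumption; repeat f_equal; lia.
Qed.

Lemma lsum_root th (F : nat -> R) m :
  lsum (fun j => if Nat.eqb j 0 then th * F j else F j) (seq 0 (S m)) =
  th * F O + lsum F (seq 1 m).
Proof.
  cbn [seq]; rewrite lsum_cons; simpl Nat.eqb; cbv iota; f_equal.
  apply lsum_ext; intros j Hj; apply in_seq in Hj; destruct j; [lia|reflexivity].
Qed.

Lemma lsum_one {A} (l : list A) : lsum (fun _ => 1) l = INR (length l).
Proof.
  induction l as [|x l IH]; [reflexivity|]; rewrite lsum_cons, IH; simpl length; rewrite S_INR; lra.
Qed.

Lemma lsum_root_weights th m :
  lsum (fun j => if Nat.eqb j 0 then th else 1) (seq 0 (S m)) = th + INR m.
Proof.
  rewrite (lsum_ext _ (fun j => if Nat.eqb j 0 then th * 1 else 1)).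
  - rewrite (lsum_root th (fun _ => 1)), lsum_one, length_seq; lra.
  - intros j _; destruct (Nat.eqb j 0); lra.
Qed.

Lemma weight_caps th c s : weight (caps th c s) = th + INR (length s).
Proof.
  unfold weight, caps; rewrite lsum_map; cbn [fst]; apply lsum_root_weights.
Qed.

Lemma hoppe_weight_from_app th s j : forall k,
  hoppe_weight_from th k (s ++ [j]) = hoppe_weight_from th k s *
    ((if Nat.eqb j 0 then th else 1) / (th + INR (k + length s))).
Proof.
  induction s as [|p s IH]; intros k; cbn [app hoppe_weight_from length].
  - rewrite Nat.add_0_r; ring.
  - rewrite IH, Nat.add_succ_comm; ring.
Qed.

Lemma hoppe_weight_snoc th s j : hoppe_weight th (s ++ [j]) =
  hoppe_weight th s * ((if Nat.eqb j 0 then th else 1) / (th + INR (length s))).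
Proof. apply hoppe_weight_from_app. Qed.

Lemma hoppe_weight_pos th s : 0 < th -> 0 <= hoppe_weight th s.
Proof.
  intros H; unfold hoppe_weight; generalize O; induction s as [|p s IH]; intros k; simpl; [lra|].
  apply Rmult_le_pos; [|apply IH]; pose proof (pos_INR k).
  apply Rdiv_le_0_compat; [destruct Nat.eqb|]; lra.
Qed.

Lemma hoppe_sum_succ th (F : list nat -> R) m :
  lsum (fun s => hoppe_weight th s * F s) (parent_lists (S m)) =
  lsum (fun s => hoppe_weight th s *
    (lsum (fun j => (if Nat.eqb j 0 then th else 1) * F (s ++ [j])) (seq 0 (S m)) / (th + INR m)))
    (parent_lists m).
Proof.
  cbn [parent_lists]; rewrite lsum_flat_map; apply lsum_ext; intros s Hs; rewrite lsum_map.
  unfold Rdiv; rewrite (Rmult_comm (lsum _ _)), <- Rmult_assoc, <- lsum_scal.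
  apply lsum_ext; intros j _; rewrite hoppe_weight_snoc, (parent_lists_length m s Hs).
  unfold Rdiv; ring.
Qed.

Lemma hoppe_weight_total th m : 0 < th -> lsum (hoppe_weight th) (parent_lists m) = 1.
Proof.
  intros H; rewrite (lsum_ext _ (fun s => hoppe_weight th s * 1)) by (intros; ring).
  induction m as [|m IH].
  - unfold lsum; simpl; unfold hoppe_weight; simpl; ring.
  - rewrite hoppe_sum_succ; etransitivity; [|exact IH]; apply lsum_ext; intros s _; f_equal.
    rewrite (lsum_ext _ (fun j => if Nat.eqb j 0 then th else 1)) by (intros; apply Rmult_1_r).
    rewrite lsum_root_weights; pose proof (pos_INR m); field; lra.
Qed.

Lemma height_lt s c : (height s < c)%nat <->
  forallb (fun p => 0 <? snd p)%nat (caps 1 c s) = true.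
Proof.
  unfold height, caps; rewrite forallb_forall.
  transitivity (Forall (fun j => (depth s j < c)%nat) (seq 0 (S (length s)))).
  (* A maximum over no nodes would be 0, which is not below [c = 0]; the root excludes this case. *)
  - assert (H : seq 0 (S (length s)) <> []) by discriminate; revert H.
    generalize (seq 0 (S (length s))); intros l Hl.
    destruct l as [|x l]; [easy|]; clear Hl; revert x.
    induction l as [|y l IH]; intros x.
    + simpl; rewrite Nat.max_0_r; split; [intros; repeat constructor; assumption|].
      intros F; now inversion F.
    + cbn [map fold_right] in *; split; intros H.
      * constructor; [lia|]; apply IH; lia.
      * inversion H; subst; assert (Nat.max (depth s y) (fold_right Nat.max 0 (map (depth s) l)) < c)%nat
          by now apply IH. lia.
  - rewrite Forall_forall; split; intros H.
    + intros p Hp; apply in_map_iff in Hp; destruct Hp as (j & <- & Hj).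
      apply Nat.ltb_lt; specialize (H j Hj); simpl; lia.
    + intros j Hj; specialize (H _ (in_map _ _ _ Hj)); apply Nat.ltb_lt in H; simpl in H; lia.
Qed.

Lemma alive_caps th c s : alive (caps th c s) = if (height s <? c)%nat then 1 else 0.
Proof.
  assert (E : alive (caps th c s) = alive (caps 1 c s)).
  { unfold alive; replace (forallb _ (caps th c s)) with
      (forallb (fun p : R * nat => 0 <? snd p)%nat (caps 1 c s)); [reflexivity|].
    unfold caps; induction (seq 0 (S (length s))) as [|j l IH]; [reflexivity|].
    cbn [map forallb snd]; now rewrite IH. }
  rewrite E; unfold alive; destruct (Nat.ltb_spec (height s) c) as [H|H].
  - now rewrite (proj1 (height_lt s c) H).
  - destruct forallb eqn:F; [|reflexivity]; apply height_lt in F; lia.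
Qed.

(** [surv] unfolds from the first remaining insertion, while parent lists grow at their end. Each
    induction step moves one insertion from [surv] into the list, hence the general [m]. *)
Lemma hoppe_surv th c r : 0 < th -> forall m,
  lsum (fun s => hoppe_weight th s * surv r (caps th c s)) (parent_lists m) =
  lsum (fun s => hoppe_weight th s * (if (height s <? c)%nat then 1 else 0)) (parent_lists (r + m)).
Proof.
  intros H; induction r as [|r IH]; intros m.
  - apply lsum_ext; intros s _; f_equal; apply alive_caps.
  - rewrite Nat.add_succ_comm, <- IH, hoppe_sum_succ; apply lsum_ext; intros s Hs; f_equal.
    pose proof (parent_lists_length m s Hs) as L.
    cbn [surv]; rewrite weight_caps, L; f_equal.
    unfold caps at 2; rewrite lsum_map, L; apply lsum_ext; intros j Hj; cbn [fst]; f_equal.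
    apply in_seq in Hj; rewrite caps_snoc; [reflexivity|now apply parent_lists_le with m|lia].
Qed.

Lemma hoppe_height_lt th c m : 0 < th ->
  lsum (fun s => hoppe_weight th s * (if (height s <? c)%nat then 1 else 0)) (parent_lists m) =
  surv m [(th, c)].
Proof.
  intros H; rewrite <- (Nat.add_0_r m) at 1; rewrite <- hoppe_surv by assumption.
  change (hoppe_weight th [] * surv m [(th, (c - 0)%nat)] + 0 = surv m [(th, c)]).
  rewrite Nat.sub_0_r; unfold hoppe_weight; simpl hoppe_weight_from; ring.
Qed.

Lemma prob_height_ge_bound th n f a c : 0 < th -> (forall h, a <= f h -> (c <= h)%nat) ->
  prob_height_ge th n f a <= 1 - surv (n - 1) [(th, c)].
Proof.
  intros H Hc.
  apply Rle_trans with (lsum (fun s => hoppe_weight th s +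
    (-1) * (hoppe_weight th s * (if (height s <? c)%nat then 1 else 0))) (parent_lists (n - 1))).
  - apply lsum_le; intros s _; pose proof (hoppe_weight_pos th s H).
    destruct (Rle_dec a (f (height s))) as [Ha|Ha].
    + specialize (Hc _ Ha); destruct (Nat.ltb_spec (height s) c); [lia|lra].
    + destruct (height s <? c)%nat; lra.
  - rewrite lsum_plus, lsum_scal, hoppe_weight_total, hoppe_height_lt by assumption; lra.
Qed.

Lemma prob_height_le_bound th n f a c : 0 < th -> (forall h, f h <= a -> (h < c)%nat) ->
  prob_height_le th n f a <= surv (n - 1) [(th, c)].
Proof.
  intros H Hc; rewrite <- hoppe_height_lt by assumption.
  apply lsum_le; intros s _; pose proof (hoppe_weight_pos th s H).
  destruct (Rle_dec (f (height s)) a) as [Ha|Ha].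
  - specialize (Hc _ Ha); destruct (Nat.ltb_spec (height s) c); [lra|lia].
  - destruct (height s <? c)%nat; lra.
Qed.

Lemma prob_height_le_1 th n P Pdec : 0 < th -> prob_height th n P Pdec <= 1.
Proof.
  intros H; rewrite <- (hoppe_weight_total th (n - 1) H); apply lsum_le; intros s _.
  pose proof (hoppe_weight_pos th s H); destruct (Pdec (height s)); lra.
Qed.

Lemma height_le_length s : (height s <= length s)%nat.
Proof.
  unfold height; assert (F : Forall (fun j => j <= length s)%nat (seq 0 (S (length s)))).
  { apply Forall_forall; intros j Hj; apply in_seq in Hj; lia. }
  induction F as [|j l Hj F IH]; simpl; [lia|].
  pose proof (depth_fuel_le s j j); unfold depth at 1; lia.
Qed.

Lemma nat_tail_sum N : forall h, (h <= N)%nat ->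
  lsum (fun c => 1 - (if (h <? c)%nat then 1 else 0)) (seq 1 N) = INR h.
Proof.
  intros h Hh; replace N with (h + (N - h))%nat by lia; rewrite seq_app, lsum_app.
  rewrite (lsum_ext _ (fun _ => 1)).
  2:{ intros c Hc; apply in_seq in Hc; destruct (Nat.ltb_spec h c); [lia|lra]. }
  rewrite (lsum_ext _ (fun _ => 0 * 1) (seq (1 + h) _)).
  2:{ intros c Hc; apply in_seq in Hc; destruct (Nat.ltb_spec h c); [lra|lia]. }
  rewrite lsum_scal, lsum_one, length_seq; ring.
Qed.

Lemma lsum_swap {A B} (f : A -> B -> R) l l' :
  lsum (fun a => lsum (f a) l') l = lsum (fun b => lsum (fun a => f a b) l) l'.
Proof.
  induction l as [|a l IH].
  - rewrite (lsum_ext (fun b => lsum (fun a => f a b) []) (fun _ => 0 * 0)) by (intros; unfold lsum; simpl; ring).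
    rewrite lsum_scal; unfold lsum; simpl; ring.
  - rewrite lsum_cons, IH, <- lsum_plus; apply lsum_ext; intros b _; now rewrite lsum_cons.
Qed.

(** The expectation is the sum of the probabilities of height at least [c]; these vanish for
    [c > m], so the cutoff [N] is free. *)
Lemma M_tail_sum m N : (m <= N)%nat -> M (S m) = lsum (fun c => 1 - rrt c m) (seq 1 N).
Proof.
  intros HN; unfold M, exp_height; rewrite Nat.sub_succ, Nat.sub_0_r.
  fold (lsum (fun s => hoppe_weight 1 s * INR (height s)) (parent_lists m)).
  rewrite (lsum_ext _ (fun s => lsum (fun c => hoppe_weight 1 s +
    (-1) * (hoppe_weight 1 s * (if (height s <? c)%nat then 1 else 0))) (seq 1 N))).
  - rewrite lsum_swap; apply lsum_ext; intros c _.
    rewrite lsum_plus, lsum_scal, hoppe_weight_total, hoppe_height_lt by lra; unfold rrt; ring.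
  - intros s Hs; rewrite <- (nat_tail_sum N), <- lsum_scal.
    + apply lsum_ext; intros; ring.
    + rewrite <- (parent_lists_length m s Hs) in HN; pose proof (height_le_length s); lia.
Qed.

(** * Concentration *)

Lemma exp_1_ge : 27 / 10 <= exp 1.
Proof.
  apply Rle_trans with (2 := exp_ge_taylor 1 4 ltac:(lra)).
  simpl; lra.
Qed.

(** * Geometric decay on both sides of the critical level *)

Lemma low_step_factor c x : 0 <= x < 1 ->
  low c x <= (7 + low (S c) x ^ 2) / 8 * low (S c) x.
Proof. intros Hx; pose proof (low_step c x Hx); lra. Qed.

Lemma low_incr c x : 0 <= x < 1 -> low c x <= low (S c) x.
Proof.
  intros Hx; pose proof (low_step_factor c x Hx); pose proof (low_bounds (S c) x Hx).
  assert (low (S c) x ^ 2 <= 1) by (rewrite <- (pow1 2); apply pow_incr; lra).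
  nra.
Qed.

Lemma low_mono c d x : 0 <= x < 1 -> (c <= d)%nat -> low c x <= low d x.
Proof.
  intros Hx H; induction H as [|d H IH]; [lra|]; pose proof (low_incr d x Hx); lra.
Qed.

(** A factor 3 is that of [rrt_avg_le]; a factor 2 arises because [hoppe_upper_bound] averages over
    one term fewer than the average controlled by [geo m]. *)
Lemma hoppe_surv_le th m c : 0 < th -> (1 <= c)%nat ->
  surv m [(th, c)] <= 6 * Rmax th 1 * low c (geo m).
Proof.
  intros H Hc; destruct c as [|c]; [lia|].
  assert (Ht1 : 1 <= Rmax th 1) by apply Rmax_r.
  destruct m as [|m].
  - replace (geo 0) with 0 by (unfold geo; simpl; field).
    rewrite low_at_0; pose proof (alive_bounds [(th, S c)]); simpl; lra.
  - eapply Rle_trans; [now apply hoppe_upper_bound|].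
    assert (B := rrt_avg_le c (S m)).
    assert (L := low_incr c _ (geo_bounds (S m))).
    assert (sum_f_R0 (rrt c) m <= sum_f_R0 (rrt c) (S m)).
    { simpl; pose proof (rrt_bounds c (S m)); lra. }
    assert (P : 0 <= sum_f_R0 (rrt c) m) by (apply cond_pos_sum; intros; apply rrt_bounds).
    assert (I : 1 <= INR (S m)) by (rewrite S_INR; pose proof (pos_INR m); lra).
    assert (sum_f_R0 (rrt c) m / INR (S m) <= 2 * (sum_f_R0 (rrt c) (S m) / INR (S (S m)))).
    { rewrite (S_INR (S m)); apply Rle_div_l; [lra|].
      replace (2 * (sum_f_R0 (rrt c) (S m) / (INR (S m) + 1)) * INR (S m))
        with (sum_f_R0 (rrt c) (S m) * (2 * INR (S m) / (INR (S m) + 1))) by (field; lra).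
      assert (1 <= 2 * INR (S m) / (INR (S m) + 1)) by (apply Rle_div_r; lra).
      nra. }
    replace (Rmax th 1 / INR (S m) * sum_f_R0 (rrt c) m)
      with (Rmax th 1 * (sum_f_R0 (rrt c) m / INR (S m))) by (field; lra).
    rewrite (Rmult_comm 6), Rmult_assoc; apply Rmult_le_compat_l; lra.
Qed.

Lemma hoppe_surv_ge th m c : 0 < th ->
  1 - surv m [(th, S c)] <= 3 * (1 - low c (geo m)).
Proof.
  intros H; apply Rle_trans with (2 := rrt_tail_le c m); apply Rplus_le_compat_l, Ropp_le_contravar.
  destruct m as [|m].
  - pose proof (rrt_bounds c 0); simpl; unfold alive; simpl; lra.
  - apply Rle_trans with (rrt c m); [apply rrt_decr|now apply hoppe_lower_bound].
Qed.

Lemma low_1_ge x : 0 <= x < 1 -> 1 - x <= low 1 x.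
Proof.
  intros Hx; pose proof (sum_le_geom_mean (rrt 1) 0 x Hx (rrt_bounds 1)) as H.
  simpl in H; unfold low; rewrite gf_Series.
  apply Rle_trans with ((1 - x) * 1); [lra|]; apply Rmult_le_compat_l; [lra|].
  change (rrt 1 0) with 1 in H; lra.
Qed.

Lemma high_small x : 0 <= x < 1 -> forall e, 0 < e -> exists c, 1 - low c x < e.
Proof.
  (* With [u = low (S c) x], [low_step] gives [1 - low c x >= (1 - u) (1 + (u + u^2) / 8)], and
     [u >= 1 - x]. This rate depends on [x] and serves only to find some level. *)
  intros Hx e He; set (q := / (1 + (1 - x) / 8)).
  assert (Hq : 0 < q < 1).
  { unfold q; split; [apply Rinv_0_lt_compat; lra|].
    rewrite <- Rinv_1; apply Rinv_lt_contravar; lra. }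
  assert (B : forall c, 1 - low c x <= q ^ c).
  { induction c as [|c IH]; [rewrite low_0; simpl; lra|].
    pose proof (low_step c x Hx); pose proof (low_bounds (S c) x Hx).
    assert (1 - x <= low (S c) x).
    { apply Rle_trans with (1 := low_1_ge x Hx); apply low_mono; [assumption|lia]. }
    simpl; apply Rle_trans with (q * (1 - low c x)); [|apply Rmult_le_compat_l; lra].
    unfold q; rewrite Rmult_comm; apply Rle_div_r; [lra|].
    set (u := low (S c) x) in *.
    assert (0 <= (1 - u) * (u ^ 2 + (u - (1 - x)))) by (apply Rmult_le_pos; [|pose proof (pow2_ge_0 u)]; lra).
    lra. }
  destruct (pow_lt_1_zero q ltac:(rewrite Rabs_pos_eq; lra) e He) as [N HN].
  exists N; specialize (HN N (Nat.le_refl N)); specialize (B N).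
  pose proof (pow_le q N ltac:(lra)); rewrite Rabs_pos_eq in HN; lra.
Qed.

(** [S K] is the first level with [low] above 5/6; [K] is the centre for both tails and for [M]. *)
Lemma level_exists x : 0 <= x < 1 -> exists K,
  1 - low (S K) x < 1 / 6 /\ forall c, (c <= K)%nat -> low c x <= 5 / 6.
Proof.
  intros Hx; destruct (high_small x Hx (1 / 6) ltac:(lra)) as [c Hc]; revert Hc.
  induction c as [|c IH]; intros Hc; [rewrite low_0 in Hc; lra|].
  destruct (Rlt_or_le (1 - low c x) (1 / 6)) as [H|H]; [now apply IH|].
  exists c; split; [assumption|]; intros d Hd; pose proof (low_mono d c x Hx Hd); lra.
Qed.

(** Above [K], [low >= 5/6] turns the factor 3/2 of [high_step] into 5/4. *)
Lemma high_above x K : 0 <= x < 1 -> 1 - low (S K) x < 1 / 6 ->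
  forall c, (S K <= c)%nat -> 1 - low (S c) x <= 4 / 5 * (1 - low c x).
Proof.
  intros Hx HK c Hc; pose proof (high_step c x Hx); pose proof (low_bounds (S c) x Hx).
  assert (low (S K) x <= low (S c) x) by (apply low_mono; [assumption|lia]).
  assert (0 <= (1 - low (S c) x) * (low (S c) x - 5 / 6)) by (apply Rmult_le_pos; lra).
  lra.
Qed.

Lemma high_geometric x K : 0 <= x < 1 -> 1 - low (S K) x < 1 / 6 ->
  forall j, 1 - low (S K + j) x <= (4 / 5) ^ j / 6.
Proof.
  intros Hx HK j; induction j as [|j IH]; [rewrite Nat.add_0_r; simpl; lra|].
  rewrite Nat.add_succ_r; pose proof (high_above x K Hx HK (S K + j) ltac:(lia)); simpl pow; lra.
Qed.

Lemma high_sum x K : 0 <= x < 1 -> 1 - low (S K) x < 1 / 6 ->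
  forall p c, (S K <= c)%nat ->
  lsum (fun c => 1 - low c x) (seq (S c) p) <= 4 * (1 - low c x).
Proof.
  intros Hx HK p; induction p as [|p IH]; intros c Hc; pose proof (low_bounds c x Hx).
  - unfold lsum; simpl; lra.
  - cbn [seq]; rewrite lsum_cons; specialize (IH (S c) ltac:(lia)).
    pose proof (high_above x K Hx HK c Hc); lra.
Qed.

(** The ratio is [277/288 = (7 + (5/6)^2) / 8]; its geometric series sums to 288/11. *)
Lemma low_below x K : 0 <= x < 1 -> (forall c, (c <= K)%nat -> low c x <= 5 / 6) ->
  forall c, (S c <= K)%nat -> low c x <= 277 / 288 * low (S c) x.
Proof.
  intros Hx HK c Hc; pose proof (low_step_factor c x Hx); pose proof (low_bounds (S c) x Hx).
  assert (low (S c) x ^ 2 <= (5 / 6) ^ 2) by (apply pow_incr; split; [lra|now apply HK]).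
  nra.
Qed.

Lemma low_geometric_slow x K : 0 <= x < 1 -> (forall c, (c <= K)%nat -> low c x <= 5 / 6) ->
  forall j c, (c + j = K)%nat -> low c x <= (277 / 288) ^ j.
Proof.
  intros Hx HK j; induction j as [|j IH]; intros c Hc; [apply low_bounds; assumption|].
  pose proof (low_below x K Hx HK c ltac:(lia)); specialize (IH (S c) ltac:(lia)); simpl; lra.
Qed.

Lemma low_sum x K : 0 <= x < 1 -> (forall c, (c <= K)%nat -> low c x <= 5 / 6) ->
  forall c, (c <= K)%nat ->
  lsum (fun c => low c x) (seq 0 (S c)) <= 288 / 11 * low c x.
Proof.
  intros Hx HK c; induction c as [|c IH]; intros Hc.
  - unfold lsum; simpl; rewrite low_0; lra.
  - rewrite seq_S, lsum_app; specialize (IH ltac:(lia)).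
    pose proof (low_below x K Hx HK c Hc); unfold lsum at 2; cbn [map fold_right Nat.add]; lra.
Qed.

(** Sixty levels below [K] the slow rate has brought [low] under 1/10; from there on the ratio is at
    most [(7 + 1/100) / 8 = 701/800]. The constant pays for the first sixty levels. *)
Lemma low_geometric x K : 0 <= x < 1 -> (forall c, (c <= K)%nat -> low c x <= 5 / 6) ->
  forall j c, (c + j = K)%nat -> low c x <= / (701 / 800) ^ 60 * (701 / 800) ^ j.
Proof.
  intros Hx HK j c Hc; set (r := 701 / 800); assert (Hr : 0 < r <= 1) by (unfold r; lra).
  assert (P : 0 < r ^ 60) by (apply pow_lt; lra).
  apply (Rmult_le_reg_l (r ^ 60)); [assumption|].
  rewrite <- Rmult_assoc, Rinv_r, Rmult_1_l by lra.
  destruct (Nat.le_gt_cases j 60) as [Hj|Hj].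
  - replace (r ^ 60) with (r ^ j * r ^ (60 - j)) by (rewrite <- pow_add; f_equal; lia).
    pose proof (low_bounds c x Hx); pose proof (pow_lt r j ltac:(lra)).
    assert (0 < r ^ (60 - j) <= 1).
    { split; [apply pow_lt; lra|rewrite <- (pow1 (60 - j)); apply pow_incr; lra]. }
    assert (r ^ (60 - j) * low c x <= 1) by nra.
    nra.
  - assert (E : exists i, (j = 60 + i)%nat) by (exists (j - 60)%nat; lia); destruct E as [i ->].
    rewrite pow_add; apply Rmult_le_compat_l; [lra|]; clear Hj; revert c Hc.
    induction i as [|i IH]; intros c Hc; [apply low_bounds; assumption|].
    specialize (IH (S c) ltac:(lia)); pose proof (low_bounds (S c) x Hx).
    pose proof (low_step_factor c x Hx).
    assert (T : low (S c) x <= 1 / 10).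
    { apply Rle_trans with ((277 / 288) ^ (60 + i)).
      - apply (low_geometric_slow x K Hx HK); lia.
      - rewrite pow_add; assert ((277 / 288) ^ i <= 1) by (rewrite <- (pow1 i); apply pow_incr; lra).
        pose proof (pow_le (277 / 288) i ltac:(lra)).
        assert ((277 / 288) ^ 60 <= 1 / 10) by (simpl; lra). nra. }
    assert (low (S c) x ^ 2 <= (1 / 10) ^ 2) by (apply pow_incr; lra).
    simpl pow at 1; apply Rle_trans with (r * low (S c) x); [unfold r; nra|].
    apply Rmult_le_compat_l; lra.
Qed.

(** In the tail sum, levels up to [K] lose at most [3 * 288/11 * 5/6 < 66] in total, level [S K]
    adds at most 1, and all higher levels add at most [3 * 4 * 1/6 = 2]. *)
Lemma M_level m K : 1 - low (S K) (geo m) < 1 / 6 ->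
  (forall c, (c <= K)%nat -> low c (geo m) <= 5 / 6) ->
  INR K - 66 <= M (S m) <= INR K + 3.
Proof.
  intros HK HK'; pose proof (geo_bounds m) as Hx.
  rewrite (M_tail_sum m (S K + m)) by lia; rewrite seq_app, lsum_app; split.
  - assert (A : 0 <= lsum (fun c => 1 - rrt c m) (seq (1 + S K) m)).
    { apply lsum_ge_0; intros c _; pose proof (rrt_bounds c m); lra. }
    assert (B : lsum (fun c => 1 + (-3) * low c (geo m)) (seq 0 (S K))
       <= lsum (fun c => 1 - rrt c m) (seq 0 (S K))).
    { apply lsum_le; intros c _; pose proof (rrt_le_avg c m); pose proof (rrt_avg_le c m); lra. }
    rewrite lsum_plus, lsum_scal, lsum_one, length_seq, S_INR in B.
    pose proof (low_sum _ _ Hx HK' K (Nat.le_refl K)); specialize (HK' K (Nat.le_refl K)).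
    replace (seq 1 (S K)) with (seq 1 K ++ [S K]) by (symmetry; apply seq_S).
    rewrite lsum_app; unfold lsum at 2; cbn [map fold_right].
    pose proof (rrt_bounds (S K) m).
    assert (Z : lsum (fun c => 1 - rrt c m) (seq 0 (S K)) = 1 + lsum (fun c => 1 - rrt c m) (seq 1 K)).
    { cbn [seq]; rewrite lsum_cons, rrt_0; ring. }
    lra.
  - assert (A : lsum (fun c => 1 - rrt c m) (seq 1 (S K)) <= INR (S K)).
    { apply Rle_trans with (lsum (fun _ => 1) (seq 1 (S K)));
        [|rewrite lsum_one, length_seq; apply Rle_refl].
      apply lsum_le; intros c _; pose proof (rrt_bounds c m); lra. }
    assert (B : lsum (fun c => 1 - rrt c m) (seq (1 + S K) m)
       <= lsum (fun c => 3 * (1 - low c (geo m))) (seq (1 + S K) m)).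
    { apply lsum_le; intros c _; apply rrt_tail_le. }
    rewrite lsum_scal in B; rewrite S_INR in A.
    pose proof (high_sum _ _ Hx HK m (S K) (Nat.le_refl _)); change (1 + S K)%nat with (S (S K)) in *; lra.
Qed.

Lemma pow_le_exp q a j : 0 <= q <= 1 - a -> q ^ j <= exp (- a * INR j).
Proof.
  intros H; rewrite (Rmult_comm (- a)), exp_mult_INR; apply pow_incr; split; [lra|].
  pose proof (exp_ineq1_le (- a)); lra.
Qed.

Lemma exp_le_mono a b : a <= b -> exp a <= exp b.
Proof.
  intros [H| ->]; [left; now apply exp_increasing|apply Rle_refl].
Qed.

(* Turns a bound that is geometric in the integer part of [t - s] into one in [t]. *)
Lemma exp_tail (P C a q b s t : R) : 0 <= q <= 1 - a -> 0 <= a -> b <= a -> 0 < t -> 0 <= C ->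
  P <= 1 -> (forall j : nat, INR j <= t - s < INR j + 1 -> P <= C * q ^ j) ->
  P <= (C + 1) * exp (a * (Rabs s + 1)) * exp (- b * t).
Proof.
  intros Hq Ha Hb Ht HC H1 HP.
  assert (B : 0 <= (a - b) * t) by (apply Rmult_le_pos; lra).
  pose proof (Rle_abs s) as Hs; pose proof (Rabs_pos s).
  assert (E : forall y, y <= a * (Rabs s + 1) + - b * t ->
    exp y <= exp (a * (Rabs s + 1)) * exp (- b * t)).
  { intros y Hy; rewrite <- exp_plus; now apply exp_le_mono. }
  rewrite Rmult_assoc; destruct (Rle_or_lt s t) as [Hst|Hst].
  - destruct (nfloor_ex (t - s) ltac:(lra)) as [j Hj].
    apply Rle_trans with (1 := HP j Hj).
    pose proof (pow_le_exp q a j Hq) as Hp; pose proof (pow_le q j (proj1 Hq)).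
    assert (exp (- a * INR j) <= exp (a * (Rabs s + 1)) * exp (- b * t)).
    { apply E; assert (0 <= a * (INR j + 1 + Rabs s - t)) by (apply Rmult_le_pos; lra); lra. }
    apply Rmult_le_compat; lra.
  - pose proof (E 0) as E0; rewrite exp_0 in E0.
    assert (0 <= a * (Rabs s + 1 - t)) by (apply Rmult_le_pos; lra).
    specialize (E0 ltac:(lra)); nra.
Qed.

Lemma height_upper_tail th n t j : 0 < th -> (1 <= n)%nat -> INR j <= t - 70 ->
  prob_height_ge th n (fun h => INR h - M n) t <= 1 * (4 / 5) ^ j.
Proof.
  intros H Hn Hj; destruct n as [|m]; [lia|].
  destruct (level_exists _ (geo_bounds m)) as (K & HK & HK').
  pose proof (M_level m K HK HK') as HM.
  (* Here [h >= M + t >= (K - 66) + (j + 70)], which is at least [S (S K + j)]. *)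
  apply Rle_trans with (1 - surv (S m - 1) [(th, S (S K + j))]).
  - apply prob_height_ge_bound; [assumption|]; intros h Hh.
    apply INR_le; rewrite !S_INR, plus_INR, S_INR; lra.
  - rewrite Nat.sub_succ, Nat.sub_0_r.
    apply Rle_trans with (1 := hoppe_surv_ge th m (S K + j) H).
    pose proof (high_geometric _ _ (geo_bounds m) HK j); pose proof (pow_le (4 / 5) j); lra.
Qed.

Lemma height_lower_tail th n t j : 0 < th -> (1 <= n)%nat -> INR j <= t - 5 ->
  prob_height_le th n (fun h => INR h - M n) (- t) <=
    6 * Rmax th 1 * / (701 / 800) ^ 60 * (701 / 800) ^ j.
Proof.
  intros H Hn Hj; destruct n as [|m]; [lia|].
  destruct (level_exists _ (geo_bounds m)) as (K & HK & HK').
  pose proof (M_level m K HK HK') as HM.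
  assert (HR : 1 <= Rmax th 1) by apply Rmax_r.
  (* Here [h <= M - t <= (K + 3) - (j + 5)], hence [h < K - j]. *)
  apply Rle_trans with (surv (S m - 1) [(th, (K - j)%nat)]).
  - apply prob_height_le_bound; [assumption|]; intros h Hh.
    assert (h + j < K)%nat; [|lia].
    apply INR_lt; rewrite plus_INR; lra.
  - rewrite Nat.sub_succ, Nat.sub_0_r.
    destruct (Nat.le_gt_cases K j) as [Hc|Hc].
    (* With capacity 0 the root is dead from the start, so the probability vanishes. *)
    + replace (K - j)%nat with O by lia.
      apply Rle_trans with 0.
      * clear - H; induction m as [|m IH]; [unfold surv, alive; simpl; lra|].
        apply Rle_trans with (surv m [(th, O)]); [|exact IH].
        apply surv_decr; [apply nonneg_single; lra|rewrite weight_single; lra].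
      * apply Rmult_le_pos; [|apply pow_le; lra]; apply Rmult_le_pos; [lra|].
        left; apply Rinv_0_lt_compat, pow_lt; lra.
    + apply Rle_trans with (1 := hoppe_surv_le th m (K - j) H ltac:(lia)).
      rewrite (Rmult_assoc (6 * Rmax th 1)); apply Rmult_le_compat_l; [lra|].
      apply (low_geometric _ _ (geo_bounds m) HK'); lia.
Qed.

Theorem theorem2p3 :
  (forall beta : R, beta < 1 / (2 * exp 1) ->
     exists Cb : R, 0 < Cb /\
       forall th : R, 0 < th ->
       forall (n : nat) (t : R), (1 <= n)%nat -> 0 < t ->
         prob_height_ge th n (fun h => INR h - M n) t <= Cb * exp (- beta * t))
  /\
  (forall th : R, 0 < th ->
   forall alpha : R, alpha < 1 / (3 * exp 1) ->
     exists Ca : R, 0 < Ca /\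
       forall (n : nat) (t : R), (1 <= n)%nat -> 0 < t ->
         prob_height_le th n (fun h => INR h - M n) (- t) <= Ca * exp (- alpha * t)).
Proof.
  (* [e >= 27/10] gives [4/5 <= 1 - 1/(2e)] and [701/800 <= 1 - 1/(3e)], the conditions on the
     ratios in [exp_tail]. *)
  pose proof exp_1_ge as He.
  assert (I : forall k, 0 < k -> 0 <= 1 / (k * exp 1) <= 1 / (k * (27 / 10))).
  { intros k Hk; split; [apply Rdiv_le_0_compat; nra|].
    apply Rmult_le_compat_l; [lra|]; apply Rinv_le_contravar; nra. }
  split.
  - intros beta Hb; specialize (I 2 ltac:(lra)).
    (* The endpoint rate [a] covers every smaller [beta]. The constant is chosen before [th] is
       introduced, so it is uniform in [th]. *)
    eexists; split; [|intros th H n t Hn Ht;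
      apply exp_tail with (C := 1) (a := 1 / (2 * exp 1)) (q := 4 / 5) (s := 70)].
    all: try lra.
    + repeat apply Rmult_lt_0_compat; [lra|apply exp_pos].
    + now apply prob_height_le_1.
    + intros j Hj; apply height_upper_tail; auto; lra.
  - intros th H alpha Ha; specialize (I 3 ltac:(lra)).
    assert (HC : 0 <= 6 * Rmax th 1 * / (701 / 800) ^ 60).
    { assert (HR : 1 <= Rmax th 1) by apply Rmax_r.
      apply Rmult_le_pos; [lra|]; left; apply Rinv_0_lt_compat, pow_lt; lra. }
    eexists; split; [|intros n t Hn Ht; apply exp_tail with
      (C := 6 * Rmax th 1 * / (701 / 800) ^ 60) (a := 1 / (3 * exp 1)) (q := 701 / 800) (s := 5)].
    + apply Rmult_lt_0_compat; [lra|apply exp_pos].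
    + lra.
    + lra.
    + lra.
    + assumption.
    + assumption.
    + now apply prob_height_le_1.
    + intros j Hj; apply height_lower_tail; auto; lra.
Qed.
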